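(* Let $G=(V,E)$ be a finite simple undirected graph, $s\in V$ and $W\subseteq V$. Then the number of orientations of $G$ in which every $w\in W$ is reachable from $s$ by a directed path equals the number of subsets $X\subseteq E$ such that all vertices of $W\cup\{s\}$ lie in a single connected component of $(V,X)$.
   Context: An orientation of $G$ assigns a direction to each edge. *)

(* Defs.v *)
From mathcomp Require Import all_boot.

Set Implicit Arguments.
Unset Strict Implicit.
Unset Printing Implicit Defensive.

Section Graphs.
Variable V : finType.
Implicit Types (E X : {set {set V}}) (D : {set V * V}).

(* The edges of a simple graph on V are two-element subsets of V: no loops, no
   multiple edges. *)
Definition simple_graph E : bool := [forall f in E, #|f| == 2].

Definition adj X : rel V := [rel x y | [set x; y] \in X].

Definition components X : {set {set V}} :=
  equivalence_partition (connect (adj X)) [set: V].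

(* An orientation is given by its set of arcs, (x, y) being the arc from x to
   y; (+) is exclusive or, so each edge gets exactly one of its two
   directions. *)
Definition orientation E D : bool :=
  [forall x, forall y,
     if [set x; y] \in E then ((x, y) \in D) (+) ((y, x) \in D)
     else (x, y) \notin D].

Definition arc D : rel V := [rel x y | (x, y) \in D].

(* connect is the reflexive transitive closure, so s is reachable from s by
   the path of length 0. *)
Definition reachable D (s w : V) : bool := connect (arc D) s w.

End Graphs.

(* Main.v *)
Require Import Defs.
From mathcomp Require Import all_boot.

(** Explore the graph from [s] one edge at a time, keeping the set [R] of
    vertices found so far and the set [F] of edges not yet inspected. For an
    edge of [F] from [x] in [R] to [y] outside [R], orienting it [x -> y] has
    the same effect as keeping it in [X]: [y] joins [R]. Orienting it
    [y -> x] has the same effect as dropping it: [R] is unchanged. Both counts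
    thus satisfy the same recursion on [#|F|]. When no edge of [F] leaves [R],
    the condition is [W \subset R] on both sides, and [F] has as many
    orientations as subsets. *)

Section Exploration.
Set Implicit Arguments.
Unset Strict Implicit.
Unset Printing Implicit Defensive.

Variable V : finType.
Implicit Types (E F X : {set {set V}}) (D : {set V * V}) (R W : {set V}).
Implicit Types (e : rel V).

(** * Reachability from a set of vertices *)

Definition reach e R : {set V} := [set w | [exists r in R, connect e r w]].

Lemma reach_seed e R r : r \in R -> r \in reach e R.
Proof. by move=> rR; rewrite inE; apply/exists_inP; exists r. Qed.

Lemma reach_step e R u v : u \in reach e R -> e u v -> v \in reach e R.
Proof.
rewrite !inE => /exists_inP[r rR ru] uv; apply/exists_inP; exists r => //.
exact: connect_trans ru (connect1 uv).
Qed.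

(** A path that starts in [A] cannot leave it, by induction on the path. The equalities of reach
    sets below follow from this by double inclusion. *)
Lemma reach_min e R (A : {set V}) :
    R \subset A -> (forall u v, u \in A -> e u v -> v \in A) ->
  reach e R \subset A.
Proof.
move=> /subsetP sRA closA; apply/subsetP=> w; rewrite inE.
case/exists_inP=> r /sRA rA /connectP[p + ->].
elim: p r rA => //= v p IHp r rA /andP[rv pv].
exact: IHp (closA _ _ rA rv) pv.
Qed.

(** The new step from [x] makes [y] a seed, and a new step into [R] finds nothing. The alternative
    [v \in R] serves the undirected case, where keeping an edge also adds the step from [y] back to
    [x]. *)
Lemma reach_add e e' R x y :
    x \in R -> (forall u v, e u v -> e' u v) -> e' x y ->
    (forall u v, e' u v -> [|| e u v, v == y | v \in R]) ->
  reach e' R = reach e (y |: R).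
Proof.
move=> xR see' e'xy e'P; apply/eqP; rewrite eqEsubset; apply/andP; split.
- apply: reach_min => [|u v uA /e'P/or3P[euv|/eqP->|vR]].
  + by apply/subsetP=> r rR; rewrite reach_seed // setU1r.
  + exact: reach_step uA euv.
  + by rewrite reach_seed // setU11.
  + by rewrite reach_seed // setU1r.
- apply: reach_min => [|u v uA /see'].
  + apply/subsetP=> r /setU1P[->|]; last exact: reach_seed.
    by apply: reach_step e'xy; apply: reach_seed.
  + exact: reach_step.
Qed.

(** Steps that end at a seed discover nothing: this is the case of an edge oriented towards [R]. *)
Lemma reach_skip e e' R :
    (forall u v, e u v -> e' u v) ->
    (forall u v, e' u v -> e u v || (v \in R)) ->
  reach e' R = reach e R.
Proof.
move=> see' e'P; apply/eqP; rewrite eqEsubset; apply/andP; split.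
- apply: reach_min => [|u v uA /e'P/orP[euv|vR]].
  + by apply/subsetP=> r rR; rewrite reach_seed.
  + exact: reach_step uA euv.
  + exact: reach_seed.
- apply: reach_min => [|u v uA /see']; last exact: reach_step.
  by apply/subsetP=> r rR; rewrite reach_seed.
Qed.

Lemma reach_closed e R :
  (forall u v, u \in R -> e u v -> v \in R) -> reach e R = R.
Proof.
move=> closR; apply/eqP; rewrite eqEsubset reach_min //=.
by apply/subsetP=> r; apply: reach_seed.
Qed.

(** * Splitting families of subsets and orientations at one edge *)

Lemma eq_set2 (x y u v : V) :
  ([set u; v] == [set x; y]) = ((u, v) == (x, y)) || ((u, v) == (y, x)).
Proof.
apply/eqP/orP=> [eq_uv|[]/eqP[-> ->]//]; last by rewrite setUC.
have : u \in [set x; y] by rewrite -eq_uv set21.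
have : v \in [set x; y] by rewrite -eq_uv set22.
have : x \in [set u; v] by rewrite eq_uv set21.
have : y \in [set u; v] by rewrite eq_uv set22.
rewrite !inE => /orP[]/eqP-> /orP[]/eqP->; rewrite ?orbb ?eqxx; auto.
  by move=> /eqP->; auto.
by move=> _ /eqP->; auto.
Qed.

(** Inserting [a] is a bijection from the right family to the left one, with inverse the removal of
    [a]. *)
Lemma card_family_mem (T : finType) (a : T) (Q : pred {set T}) :
  #|[set D : {set T} | Q D & a \in D]|
  = #|[set D : {set T} | a \notin D & Q (a |: D)]|.
Proof.
rewrite -(card_in_imset (f := fun D : {set T} => a |: D)
                        (D := [set D : {set T} | a \notin D & Q (a |: D)])).
  apply: eq_card => D; rewrite inE; apply/andP/imsetP.
    case=> QD aD; exists (D :\ a); last by rewrite setD1K.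
    by rewrite inE setD11 setD1K.
  by case=> D'; rewrite inE => /andP[aD' QD'] ->; rewrite setU11.
move=> D1 D2; rewrite !inE => /andP[aD1 _] /andP[aD2 _] eqD.
by rewrite -(setU1K aD1) eqD setU1K.
Qed.

Lemma card_subsets_edge F f (P : pred {set {set V}}) : f \in F ->
  #|[set X : {set {set V}} | X \subset F & P X]|
  = #|[set X : {set {set V}} | X \subset F :\ f & P (f |: X)]|
    + #|[set X : {set {set V}} | X \subset F :\ f & P X]|.
Proof.
move=> fF; rewrite -(cardsID [set X : {set {set V}} | f \in X]); congr (_ + _).
  transitivity
    #|[set X : {set {set V}} | (X \subset F) && P X & f \in X]|.
    by apply: eq_card => X; rewrite !inE.
  rewrite (card_family_mem _ (fun X => (X \subset F) && P X)).
  apply: eq_card => X; rewrite !inE subUset sub1set fF /= subsetD1.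
  by rewrite andbA [(f \notin X) && _]andbC.
apply: eq_card => X; rewrite !inE subsetD1.
by rewrite andbA [(f \notin X) && _]andbC.
Qed.

Lemma orientationP E D :
  reflect (forall x y, if [set x; y] \in E
                       then ((x, y) \in D) (+) ((y, x) \in D)
                       else (x, y) \notin D)
          (orientation E D).
Proof.
apply: (iffP forallP) => [H x y|H x]; first exact: (forallP (H x)).
exact/forallP.
Qed.

Lemma orientation_arc E D u v :
  orientation E D -> (u, v) \in D -> [set u; v] \in E.
Proof. by move/orientationP/(_ u v); case: ifP => // _ /negP. Qed.

(** Once the edge is removed, an orientation contains neither of its two arcs, so exactly one of
    them can be put back. For a loop the two arcs would coincide and the exclusive or would fail. *)
Lemma orientationU1 F x y D : x != y -> [set x; y] \in F ->
  ((x, y) \notin D) && orientation F ((x, y) |: D)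
  = orientation (F :\ [set x; y]) D.
Proof.
move=> neq_xy xyF.
have neq_yx : (y == x) = false by rewrite eq_sym (negPf neq_xy).
apply/andP/orientationP => [[xyD /orientationP H] u v|H].
  have yxD : (y, x) \notin D.
    move: (H x y); rewrite xyF setU11 !inE xpair_eqE neq_yx /=.
    by case: (_ \in D).
  move: (H u v); rewrite in_setD1 eq_set2 !in_setU1.
  have [[-> ->] //|_] := eqVneq (u, v) (x, y).
  have [[-> ->] //|neq_uv] := eqVneq (u, v) (y, x).
  (* For any other pair, neither [(u, v)] nor its reverse is the added arc, so the condition is
     unchanged. *)
  suff -> : ((v, u) == (x, y)) = false by [].
  by apply: contraNF neq_uv; rewrite !xpair_eqE andbC.
have xyD : (x, y) \notin D by move: (H x y); rewrite setD11.
have yxD : (y, x) \notin D by move: (H y x); rewrite [[set y; x]]setUC setD11.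
split=> //; apply/orientationP=> u v.
move: (H u v); rewrite in_setD1 eq_set2 !in_setU1.
have [[-> ->] _|neq_xy'] := eqVneq (u, v) (x, y).
  by rewrite xyF xpair_eqE neq_yx /= (negPf yxD).
have [[-> ->] _|neq_uv] := eqVneq (u, v) (y, x).
  by rewrite setUC xyF eqxx (negPf yxD).
suff -> : ((v, u) == (x, y)) = false by [].
by apply: contraNF neq_uv; rewrite !xpair_eqE andbC.
Qed.

Lemma card_orientations_edge F x y (P : pred {set V * V}) :
    x != y -> [set x; y] \in F ->
  #|[set D : {set V * V} | orientation F D & P D]|
  = #|[set D : {set V * V} | orientation (F :\ [set x; y]) D
                           & P ((x, y) |: D)]|
    + #|[set D : {set V * V} | orientation (F :\ [set x; y]) D
                             & P ((y, x) |: D)]|.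
Proof.
have half u v : u != v -> [set u; v] \in F ->
    #|[set D : {set V * V} | orientation F D && P D & (u, v) \in D]|
    = #|[set D : {set V * V} | orientation (F :\ [set u; v]) D
                             & P ((u, v) |: D)]|.
  move=> neq_uv uvF.
  rewrite (card_family_mem _ (fun D => orientation F D && P D)).
  by apply: eq_card => D; rewrite !inE andbA orientationU1.
move=> neq_xy xyF.
rewrite -(half x y) // [in X in _ + X]setUC -(half y x); first last.
- by rewrite setUC.
- by rewrite eq_sym.
rewrite -(cardsID [set D : {set V * V} | (x, y) \in D]); congr (_ + _).
  by apply: eq_card => D; rewrite !inE.
(* In an orientation of [F], avoiding [(x, y)] amounts to containing [(y, x)]. *)
apply: eq_card => D; rewrite !inE andbC.
have [/orientationP/(_ x y)|//] := boolP (orientation F D).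
rewrite xyF /=; case: (P D) => //=.
by case: (_ \in D); case: (_ \in D).
Qed.

(** * Equality of the two counts, by induction on the edges *)

Lemma simple_graph_pair F f :
  simple_graph F -> f \in F -> exists x y, x != y /\ f = [set x; y].
Proof.
by move=> /forall_inP H /H/cards2P[x [y [? ->]]]; exists x, y.
Qed.

Lemma simple_graphD1 F f : simple_graph F -> simple_graph (F :\ f).
Proof.
by move=> /forall_inP H; apply/forall_inP=> g /setD1P[_ /H].
Qed.

(** Both counts double with each edge. The trivial predicate is kept in the induction so that the
    two splitting lemmas apply. *)
Lemma card_orientations F : simple_graph F ->
  #|[set D : {set V * V} | orientation F D]|
  = #|[set X : {set {set V}} | X \subset F]|.
Proof.
suff H : forall n F, #|F| = n -> simple_graph F ->
    #|[set D : {set V * V} | orientation F D & true]|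
    = #|[set X : {set {set V}} | X \subset F & true]|.
  move=> /(H _ _ erefl) eqF.
  transitivity #|[set D : {set V * V} | orientation F D & true]|.
    by apply: eq_card => D; rewrite !inE andbT.
  by rewrite eqF; apply: eq_card => D; rewrite !inE andbT.
elim=> [|n IHn] {}F => [/cards0_eq->|cardF] simF.
  have -> : [set D : {set V * V} | orientation set0 D & true] = [set set0].
    apply/setP=> D; rewrite !inE andbT; apply/orientationP/eqP=> [H|-> u v].
      by apply/setP=> -[u v]; move: (H u v); rewrite !inE => /negPf.
    by rewrite !inE.
  rewrite cards1; apply/esym/eqP/cards1P; exists set0.
  by apply/setP=> X; rewrite !inE andbT subset0.
have /card_gt0P[f fF] : 0 < #|F| by rewrite cardF.
have [x [y [neq_xy def_f]]] := simple_graph_pair simF fF.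
rewrite (card_subsets_edge xpredT fF).
rewrite (card_orientations_edge xpredT neq_xy) -?def_f //.
have cardF' : #|F :\ f| = n by move: cardF; rewrite (cardsD1 f) fF => -[].
by rewrite /= IHn // simple_graphD1.
Qed.

(** The exploration is stuck at [R], so the condition on [D] or [X] is the constant [W \subset R]:
    both families are full or both are empty. *)
Lemma card_reach_closed F R W : simple_graph F ->
    (forall x y, x \in R -> [set x; y] \in F -> y \in R) ->
  #|[set D : {set V * V} | orientation F D & W \subset reach (Defs.arc D) R]|
  = #|[set X : {set {set V}} | X \subset F & W \subset reach (adj X) R]|.
Proof.
move=> simF closR.
have reachD D : orientation F D -> reach (Defs.arc D) R = R.
  move=> oD; apply: reach_closed => u v uR uvD.
  exact: closR uR (orientation_arc oD uvD).
have reachX X : X \subset F -> reach (adj X) R = R.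
  move=> /subsetP sXF; apply: reach_closed => u v uR uvX.
  exact: closR uR (sXF _ uvX).
have [sWR|nsWR] := boolP (W \subset R).
  transitivity #|[set D : {set V * V} | orientation F D]|.
    apply: eq_card => D; rewrite !inE.
    by case: (boolP (orientation F D)) => //= /reachD->.
  rewrite card_orientations //; apply: eq_card => X; rewrite !inE.
  by case: (boolP (X \subset F)) => //= /reachX->.
rewrite !eq_card0 // => Z; rewrite !inE.
  by case: (boolP (Z \subset F)) => //= /reachX->; apply: negPf.
by case: (boolP (orientation F Z)) => //= /reachD->; apply: negPf.
Qed.

Lemma card_reach F R W : simple_graph F ->
  #|[set D : {set V * V} | orientation F D & W \subset reach (Defs.arc D) R]|
  = #|[set X : {set {set V}} | X \subset F & W \subset reach (adj X) R]|.
Proof.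
(* [R] varies with [F] in the induction, since the explored set grows when an edge is crossed. *)
have [n] := ubnP #|F|; elim: n => // n IHn in F R *.
rewrite ltnS => leFn simF.
have [/existsP[x /existsP[y /and3P[xR yR xyF]]]|closR] :=
  boolP [exists x, exists y, [&& x \in R, y \notin R & [set x; y] \in F]];
  last first.
  apply: card_reach_closed => // x y xR xyF; apply: contraNT closR => yR.
  by apply/existsP; exists x; apply/existsP; exists y; apply/and3P.
have neq_xy : x != y by apply: contraNneq yR => <-.
rewrite (card_subsets_edge (fun X => W \subset reach (adj X) R) xyF).
rewrite (card_orientations_edge
  (fun D => W \subset reach (Defs.arc D) R) neq_xy xyF).
have ltF'n : #|F :\ [set x; y]| < n.
  by apply: leq_trans leFn; rewrite [ltnRHS](cardsD1 [set x; y]) xyF.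
have simF' := simple_graphD1 [set x; y] simF.
(* First summands: the arc from [x] to [y], or the kept edge, turns [R] into [y |: R]. *)
congr (_ + _).
  transitivity #|[set D : {set V * V} | orientation (F :\ [set x; y]) D
                                  & W \subset reach (Defs.arc D) (y |: R)]|.
    apply: eq_card => D; rewrite !inE (@reach_add (Defs.arc D) _ R x y) //=.
    - by move=> u v; apply: setU1r.
    - exact: setU11.
    - by move=> u v; rewrite /Defs.arc /= in_setU1 => /predU1P[[_ ->]|->] //;
        rewrite eqxx orbT.
  rewrite IHn //; apply: eq_card => X.
  rewrite !inE (@reach_add (adj X) (adj ([set x; y] |: X)) R x y) //=.
  - by move=> u v; apply: setU1r.
  - exact: setU11.
  - move=> u v; rewrite /adj /= in_setU1 eq_set2 -orbA.
    by case/or3P=> [/eqP[_ ->]|/eqP[_ ->]|->] //; rewrite ?xR ?eqxx ?orbT.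
(* Second summands: the dropped edge leaves [X] as it is, so only the arc from [y] into [R] has to
   be discarded. *)
rewrite -IHn //; apply: eq_card => D.
rewrite !inE (@reach_skip (Defs.arc D) (Defs.arc ((y, x) |: D))) //= => u v.
  exact: setU1r.
by rewrite /Defs.arc /= in_setU1 => /predU1P[[_ ->]|->] //; rewrite xR orbT.
Qed.

(** * Both conditions as reachability from the single seed [s] *)

Lemma exists_component_sub X s W :
  [exists C in components X, (s |: W) \subset C]
  = (W \subset reach (adj X) [set s]).
Proof.
have sym_adj : connect_sym (adj X).
  by apply: sym_connect_sym => u v; rewrite /adj /= setUC.
have in_reach w : (w \in reach (adj X) [set s]) = connect (adj X) s w.
  rewrite inE; apply/exists_inP/idP=> [[r /set1P->]//|sw].
  by exists s; rewrite ?set11.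
apply/exists_inP/subsetP=> [[_ /imsetP[x _ ->] /subsetP sC] w wW|sW].
  (* The component is given as the class of some [x]; symmetry of [adj X] leads from [s] to [w]
     through [x]. *)
  have xs : connect (adj X) x s by have := sC s; rewrite !inE eqxx; apply.
  have xw : connect (adj X) x w by have := sC w; rewrite !inE wW orbT; apply.
  by rewrite in_reach; apply: connect_trans xw; rewrite sym_adj.
exists [set y in [set: V] | connect (adj X) s y]; first exact: imset_f.
by apply/subsetP=> w /setU1P[->|/sW]; rewrite !inE ?connect0 // -in_reach inE.
Qed.

Lemma forall_reachable D s W :
  [forall w in W, reachable D s w] = (W \subset reach (Defs.arc D) [set s]).
Proof.
apply/forall_inP/subsetP=> H w /H; rewrite inE.
  by move=> sw; apply/exists_inP; exists s; rewrite // set11.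
by case/exists_inP=> r /set1P->.
Qed.

End Exploration.

Theorem theorem4p13 (V : finType) (E : {set {set V}}) (s : V) (W : {set V}) :
  simple_graph E ->
  #|[set D : {set V * V} | orientation E D & [forall w in W, reachable D s w]]|
  = #|[set X : {set {set V}} | (X \subset E)
        & [exists C in components X, (s |: W) \subset C]]|.
Proof.
move=> simE.
under eq_finset => D do rewrite forall_reachable.
under [in RHS]eq_finset => X do rewrite exists_component_sub.
exact: card_reach.
Qed.
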